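(* Let $p(\lambda)=1+\sum_{j=1}^d a_j\lambda^j\in\mathbb{C}[\lambda]$ be a scalar polynomial which is stable with respect to the open upper half-plane $H_0$. Then for every $A\in\mathbb{C}^{n,n}$ $$\|p(A)\|_F\leq\sqrt{n^d}\,\exp\Bigl(\frac1n\operatorname{tr}\operatorname{Re}(a_1A)+\frac1{2n}\bigl(|a_1|^2-2\operatorname{Re}a_2\bigr)\|A\|_F^2\Bigr).$$
   Context: $H_0=\{\lambda\in\mathbb{C}:\operatorname{Im}\lambda>0\}$. A scalar polynomial is stable with respect to $H_0$ if it has no roots in $H_0$. For a square matrix $X$, $\operatorname{Re}X:=(X+X^* )/2$ and $\|X\|_F:=\sqrt{\operatorname{tr}(X^*X)}$ is the Frobenius norm. If $d=1$, then $a_2=0$. *)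

(* Defs.v *)
From HB Require Import structures.
From mathcomp Require Import all_boot all_order all_algebra.
From mathcomp Require Import all_reals all_analysis.
From mathcomp.real_closed Require Export complex.

Set Implicit Arguments.
Unset Strict Implicit.
Unset Printing Implicit Defensive.

Import Order.TTheory GRing.Theory Num.Theory.
Local Open Scope ring_scope.
Local Open Scope complex_scope.

Definition upper_half_plane (R : realType) : {pred R[i]} :=
  [pred z : R[i] | 0 < complex.Im z].
Arguments upper_half_plane R : clear implicits.

Definition stable (R : realType) (D : {pred R[i]}) (p : {poly R[i]}) : Prop :=
  forall z : R[i], z \in D -> ~~ root p z.

Definition adjmx (R : realType) (m n : nat) (X : 'M[R[i]]_(m, n)) :
  'M[R[i]]_(n, m) := map_mx conjc X^T.

Definition re_mx (R : realType) (n : nat) (X : 'M[R[i]]_n) : 'M[R[i]]_n :=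
  2^-1 *: (X + adjmx X).

                                                                                 
                                                                                 
                                                                                 
Definition frobenius_norm (R : realType) (m n : nat) (X : 'M[R[i]]_(m, n)) : R :=
  Num.sqrt (complex.Re (\tr (adjmx X *m X))).

Lemma tr_adj_mul_ge0 (R : realType) (m n : nat) (X : 'M[R[i]]_(m, n)) :
  0 <= \tr (adjmx X *m X).
Proof.
rewrite /mxtrace; apply: sumr_ge0 => i _; rewrite mxE; apply: sumr_ge0 => j _.
rewrite !mxE mulrC; exact: (mul_conjC_ge0 (X j i)).
Qed.

Lemma frobenius_normE (R : realType) (m n : nat) (X : 'M[R[i]]_(m, n)) :
  (frobenius_norm X ^+ 2)%:C = \tr (adjmx X *m X).
Proof.
rewrite /frobenius_norm; have := tr_adj_mul_ge0 X.
case: (\tr _) => a b; rewrite lecE /= => /andP[/eqP -> a0].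
by rewrite sqr_sqrtr.
Qed.

Lemma tr_re_mxE (R : realType) (n : nat) (X : 'M[R[i]]_n) :
  \tr (re_mx X) = (complex.Re (\tr X))%:C.
Proof.
have trA : \tr (adjmx X) = conjc (\tr X).
  by rewrite /adjmx /mxtrace rmorph_sum; apply: eq_bigr => i _; rewrite !mxE.
rewrite /re_mx linearZ linearD /= trA.
by rewrite (ReJ_add (\tr X)) mulrC.
Qed.

(* Main.v *)
Require Import Defs.
From mathcomp Require Import all_boot all_order all_algebra.
From mathcomp Require Import all_reals all_analysis.
From mathcomp Require Import ring lra.

(** Since [p] has constant term [1] and no root in the upper half-plane, it
factors as the product of at most [d] factors [1 + b X] with [b = - 1 / z], [z]
a root, so that [Im b <= 0]. The Frobenius norm is submultiplicative, and each
factor satisfies [|1 + b A|^2 = n + 2 Re (b tr A) + |b|^2 |A|^2 <= n exp t]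
with [n t = 2 Re (b tr A) + |b|^2 |A|^2]. Summing the exponents gives
[Re (a_1 tr A)] and the sum of the [|b|^2], which is at most
[|a_1|^2 - 2 Re a_2]: the difference is a sum of terms
[Re (b c^* ) - Re (b c) = 2 Im b Im c >= 0] over pairs of distinct factors. *)

Import Order.TTheory GRing.Theory Num.Theory.
Local Open Scope ring_scope.
Local Open Scope complex_scope.

Local Notation normc := ComplexField.Normc.normc.
Local Notation Re := complex.Re.
Local Notation Im := complex.Im.

(** * The Frobenius norm and its submultiplicativity *)

Lemma sqrtrX (R : rcfType) (x : R) (k : nat) :
  0 <= x -> Num.sqrt (x ^+ k) = Num.sqrt x ^+ k.
Proof.
move=> x_ge0; elim: k => [|k IH]; first by rewrite !expr0 sqrtr1.
by rewrite !exprS sqrtrM // IH.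
Qed.

Lemma sqr_normcE (R : realType) (z : R[i]) : normc z ^+ 2 = Re z ^+ 2 + Im z ^+ 2.
Proof. by case: z => a b /=; rewrite sqr_sqrtr // addr_ge0 ?sqr_ge0. Qed.

Lemma sqr_normc_conj (R : realType) (z : R[i]) : (normc z ^+ 2)%:C = z * z^*.
Proof. by rewrite sqr_normcE; case: z => a b; simpc; congr (_ +i* _); ring. Qed.

Lemma frobenius_norm_ge0 (R : realType) (m n : nat) (X : 'M[R[i]]_(m, n)) :
  0 <= frobenius_norm X.
Proof. exact: sqrtr_ge0. Qed.

Lemma sqr_frobenius_norm (R : realType) (m n : nat) (X : 'M[R[i]]_(m, n)) :
  frobenius_norm X ^+ 2 = \sum_i \sum_j normc (X i j) ^+ 2.
Proof.
apply: complexI; rewrite frobenius_normE exchange_big raddf_sum /=.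
apply: eq_bigr => j _; rewrite mxE raddf_sum; apply: eq_bigr => i _.
by rewrite !mxE /= sqr_normc_conj mulrC.
Qed.

Lemma cauchy_schwarz_normc (R : realType) (n : nat) (u v : 'I_n -> R[i]) :
  normc (\sum_k u k * v k) ^+ 2 <=
  (\sum_k normc (u k) ^+ 2) * (\sum_k normc (v k) ^+ 2).
Proof.
(* [dotmx] conjugates its second argument, so [v] enters conjugated to turn the inner product into
   the plain sum of [u k * v k]. *)
have [cs _] := CauchySchwarz (@spectral.dotmx _ n) (\row_k u k) (\row_k (v k)^*).
move: cs; rewrite /= !spectral.dotmxE !mxE normc_def.
rewrite (eq_bigr (fun k => u k * v k)); last first.
  by move=> k _; rewrite !mxE; congr (_ * _); exact: conjcK.
rewrite [X in X * _](eq_bigr (fun k => (normc (u k) ^+ 2)%:C)); last first.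
  by move=> k _; rewrite !mxE sqr_normc_conj.
rewrite [X in _ * X](eq_bigr (fun k => (normc (v k) ^+ 2)%:C)); last first.
  by move=> k _; rewrite !mxE sqr_normc_conj mulrC; congr (_ * _); exact: conjcK.
rewrite -!raddf_sum -rmorphXn -rmorphM /= lecR sqr_normcE.
by rewrite sqr_sqrtr // addr_ge0 ?sqr_ge0.
Qed.

Lemma frobenius_normM (R : realType) (m n p : nat)
    (X : 'M[R[i]]_(m, n)) (Y : 'M[R[i]]_(n, p)) :
  frobenius_norm (X *m Y) <= frobenius_norm X * frobenius_norm Y.
Proof.
rewrite -(@ler_pXn2r _ 2) ?nnegrE ?mulr_ge0 ?frobenius_norm_ge0 //.
rewrite exprMn !sqr_frobenius_norm mulr_suml.
apply: ler_sum => i _; rewrite exchange_big mulr_sumr /=.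
by apply: ler_sum => j _; rewrite mxE; exact: cauchy_schwarz_normc.
Qed.

(** * One linear factor and the exponent *)

Lemma sqr_frobenius_norm_1D (R : realType) (n : nat) (b : R[i])
    (A : 'M[R[i]]_n) :
  frobenius_norm (1%:M + b *: A) ^+ 2 =
  n%:R + 2 * Re (b * \tr A) + normc b ^+ 2 * frobenius_norm A ^+ 2.
Proof.
have -> : 2 * Re (b * \tr A) = \sum_(i < n) 2 * Re (b * A i i).
  rewrite -mulr_sumr; congr (_ * _); rewrite /mxtrace mulr_sumr.
  exact: (raddf_sum (@complex.Re R : {additive Rcomplex R -> R})).
rewrite !sqr_frobenius_norm mulr_sumr -[n%:R](_ : \sum_(i < n) 1 = _); last by rewrite sumr_const card_ord.
rewrite -!big_split /=; apply: eq_bigr => i _.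
(* Only the diagonal entry of each row meets the identity and yields a cross term; the others are
   just scaled by [b]. *)
rewrite mulr_sumr (bigD1 i) //= [in RHS](bigD1 i) //= addrA; congr (_ + _).
  rewrite !mxE eqxx !sqr_normcE.
  by case: b (A i i) => a c [x y] /=; ring.
apply: eq_bigr => j; rewrite eq_sym => /negPf ji.
by rewrite !mxE ji add0r ComplexField.Normc.normcM exprMn.
Qed.

(** The exponent of the theorem as a function of the first two coefficients, so that it can be
    followed through a product; a single factor has [a2 = 0]. *)
Definition growth_exponent {R : realType} {n : nat} (A : 'M[R[i]]_n)
    (a1 a2 : R[i]) : R :=
  n%:R^-1 * Re (a1 * \tr A)
  + (2 * n%:R)^-1 * (normc a1 ^+ 2 - 2 * Re a2) * frobenius_norm A ^+ 2.

Lemma frobenius_norm_1D_le (R : realType) (n : nat) (b : R[i])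
    (A : 'M[R[i]]_n.+1) :
  frobenius_norm (1%:M + b *: A) <=
  Num.sqrt n.+1%:R * expR (growth_exponent A b 0).
Proof.
rewrite -(@ler_pXn2r _ 2) ?nnegrE ?mulr_ge0 //;
  rewrite ?frobenius_norm_ge0 ?sqrtr_ge0 ?expR_ge0 //.
rewrite sqr_frobenius_norm_1D exprMn (sqr_sqrtr (ler0n R n.+1)) -expRM_natl.
(* This is [1 + t <= expR t] with [t] twice the exponent; the left side then equals the squared norm
   divided by [n.+1]. *)
apply: le_trans (ler_wpM2l (ler0n _ _) (expR_ge1Dx _)).
rewrite /growth_exponent /= le_eqVlt; apply/orP; left; apply/eqP.
by field; rewrite addrC natr1 pnatr_eq0.
Qed.

(** The right-hand coefficients are those of a polynomial [1 + a1 X + a2 X^2 + ...] multiplied by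
    [1 + b X]. The trace terms add up, and the factor of the squared norm of [A] gains
    [4 Im b Im a1], up to the positive scaling. *)
Lemma growth_exponent_mul_ge (R : realType) (n : nat) (A : 'M[R[i]]_n)
    (b a1 a2 : R[i]) :
  Im b <= 0 -> Im a1 <= 0 ->
  growth_exponent A b 0 + growth_exponent A a1 a2 <=
  growth_exponent A (b + a1) (a2 + b * a1).
Proof.
move=> b_le0 a1_le0; rewrite /growth_exponent.
have -> : Re ((b + a1) * \tr A) = Re (b * \tr A) + Re (a1 * \tr A).
  by rewrite mulrDl; case: (b * _) (a1 * _) => ? ? [].
rewrite addrACA -mulrDr lerD2l -mulrDl ler_wpM2r ?sqr_ge0 // -mulrDr.
rewrite ler_wpM2l ?invr_ge0 ?mulr_ge0 // !sqr_normcE.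
by case: b a1 a2 b_le0 a1_le0 => [x y] [z w] [s t] /=; nra.
Qed.

(** * Products of linear factors *)

Definition linear_prod {R : realType} (s : seq R[i]) : {poly R[i]} :=
  \prod_(b <- s) (1 + b *: 'X).

Lemma linear_prod_cons_coef0 (R : realType) (b : R[i]) (s : seq R[i]) :
  (linear_prod (b :: s))`_0 = (linear_prod s)`_0.
Proof.
rewrite {1}/linear_prod big_cons -/(linear_prod s).
by rewrite mulrDl mul1r -scalerAl coefD coefZ coefXM mulr0 addr0.
Qed.

Lemma linear_prod_cons_coefS (R : realType) (b : R[i]) (s : seq R[i]) (k : nat) :
  (linear_prod (b :: s))`_k.+1 =
  (linear_prod s)`_k.+1 + b * (linear_prod s)`_k.
Proof.
rewrite {1}/linear_prod big_cons -/(linear_prod s).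
by rewrite mulrDl mul1r -scalerAl coefD coefZ coefXM.
Qed.

Lemma linear_prod_coef0 (R : realType) (s : seq R[i]) : (linear_prod s)`_0 = 1.
Proof.
elim: s => [|b s IH]; first by rewrite /linear_prod big_nil coef1.
by rewrite linear_prod_cons_coef0.
Qed.

Lemma linear_prod_cons_coef1 (R : realType) (b : R[i]) (s : seq R[i]) :
  (linear_prod (b :: s))`_1 = b + (linear_prod s)`_1.
Proof. by rewrite linear_prod_cons_coefS linear_prod_coef0 mulr1 addrC. Qed.

(** This coefficient is the sum of the [b]; its sign lets [growth_exponent_mul_ge] apply to the tail
    of a product. *)
Lemma Im_linear_prod_coef1_le0 (R : realType) (s : seq R[i]) :
  {in s, forall b, Im b <= 0} -> Im (linear_prod s)`_1 <= 0.
Proof.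
elim: s => [_|b s IH sP]; first by rewrite /linear_prod big_nil coef1.
have := IH (fun c cs => sP c (mem_behead (s := b :: s) cs)).
have := sP b (mem_head _ _); rewrite linear_prod_cons_coef1.
by case: b (linear_prod s)`_1 {sP} => x y [z w] /=; lra.
Qed.

Lemma horner_mx_linear (R : realType) (n : nat) (A : 'M[R[i]]_n.+1) (b : R[i]) :
  horner_mx A (1 + b *: 'X) = 1%:M + b *: A.
Proof.
rewrite -mul_polyC rmorphD rmorph1 rmorphM /= horner_mx_C horner_mx_X.
by rewrite -mul_scalar_mx.
Qed.

(** The list is nonempty because the identity has norm [Num.sqrt n.+1%:R], which exceeds the bound 1
    of an empty product once [n > 0]. *)
Lemma frobenius_norm_linear_prod_le (R : realType) (n : nat)
    (A : 'M[R[i]]_n.+1) (b : R[i]) (s : seq R[i]) :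
  {in b :: s, forall c, Im c <= 0} ->
  frobenius_norm (horner_mx A (linear_prod (b :: s))) <=
  Num.sqrt n.+1%:R ^+ (size s).+1 *
  expR (growth_exponent A (linear_prod (b :: s))`_1 (linear_prod (b :: s))`_2).
Proof.
elim: s b => [|c s IH] b sP.
  rewrite /linear_prod big_seq1 horner_mx_linear expr1.
  rewrite !coefD !coef1 !coefZ !coefX /=.
  by rewrite mulr1 mulr0 !add0r frobenius_norm_1D_le.
have tailP : {in c :: s, forall z, Im z <= 0}.
  by move=> z zs; apply: sP; rewrite inE zs orbT.
rewrite {1}/linear_prod big_cons -/(linear_prod (c :: s)) rmorphM /=.
rewrite horner_mx_linear.
apply: le_trans (frobenius_normM R _ _ _ _ _) _.
apply: le_trans (ler_pM _ _ (frobenius_norm_1D_le _ _ _ _) (IH _ tailP)) _;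
  rewrite ?frobenius_norm_ge0 //.
rewrite mulrACA -exprS -expRD ler_wpM2l ?exprn_ge0 ?sqrtr_ge0 // ler_expR.
rewrite (linear_prod_cons_coef1 _ b) (linear_prod_cons_coefS _ b).
apply: growth_exponent_mul_ge; last exact: Im_linear_prod_coef1_le0.
by rewrite sP ?mem_head.
Qed.

(** * Factorization of a stable polynomial, and the bound *)

Lemma linear_factorization (R : realType) (p : {poly R[i]}) :
  p`_0 = 1 -> stable (upper_half_plane R) p ->
  exists2 s : seq R[i],
    p = linear_prod s & size p = (size s).+1 /\ {in s, forall b, Im b <= 0}.
Proof.
move=> p0 p_stable; have [r pE] := closed_field_poly_normal p.
have root_neq0 z : z \in r -> z != 0.
  move=> zr; apply: contra_eq_neq p0 => z0.
  rewrite -horner_coef0 pE hornerZ horner_prod (big_rem z) //= z0.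
  by rewrite hornerXsubC subr0 mul0r mulr0 eq_sym oner_neq0.
have lc_neq0 : lead_coef p != 0.
  rewrite lead_coef_eq0; apply: contra_eq_neq p0 => ->.
  by rewrite coef0 eq_sym oner_neq0.
(* Writing [X - z = (- z) (1 - X / z)], the constants [- z] cancel the leading coefficient, as
   evaluation at 0 shows. *)
have lcE : lead_coef p * \prod_(z <- r) (- z) = 1.
  rewrite -[RHS]p0 -horner_coef0 [in RHS]pE hornerZ horner_prod; congr (_ * _).
  by apply: eq_bigr => z _; rewrite hornerXsubC sub0r.
exists [seq - z^-1 | z <- r]; last split.
- rewrite {1}pE /linear_prod big_map -[lead_coef p]mulr1.
  rewrite big_seq [in RHS]big_seq.
  rewrite [in LHS](eq_bigr (fun z => (- z)%:P * (1 + - z^-1 *: 'X))); last first.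
    move=> z /root_neq0 z0; rewrite mulrDr mulr1 mul_polyC scalerA mulrNN.
    by rewrite mulfV // scale1r polyCN addrC.
  rewrite big_split /= -!big_seq -rmorph_prod mul_polyC scalerA mulr1 lcE.
  by rewrite scale1r.
- by rewrite {1}pE size_scale // size_prod_XsubC size_map.
move=> _ /mapP[z zr ->].
have : z \notin upper_half_plane R.
  by apply/negP => /p_stable; rewrite pE rootZ // root_prod_XsubC zr.
(* For [z = x + i y], the imaginary part of [- 1 / z] is [y / (x^2 + y^2)]. *)
rewrite inE -leNgt; case: z {zr} => x y /= y_le0.
by rewrite opprK mulr_le0_ge0 // invr_ge0 addr_ge0 ?sqr_ge0.
Qed.

Theorem proposition4p10 (R : realType) (n d : nat) (p : {poly R[i]})
    (A : 'M[R[i]]_n.+1)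
    (d_gt0 : (0 < d)%N)
    (p_coef : p = 1 + \sum_(1 <= j < d.+1) p`_j *: 'X^j)
    (p_stable : stable (upper_half_plane R) p) :
  frobenius_norm (horner_mx A p) <=
    Num.sqrt (n.+1%:R ^+ d) *
    expR (n.+1%:R^-1 * complex.Re (\tr (re_mx (p`_1 *: A)))
          + (2 * n.+1%:R)^-1
            * (ComplexField.Normc.normc p`_1 ^+ 2 - 2 * complex.Re p`_2)
            * frobenius_norm A ^+ 2).
Proof.
have p0 : p`_0 = 1.
  rewrite p_coef coefD coef1 coef_sum big_nat big1 ?addr0 // => j /andP[j_gt0 _].
  by rewrite coefZ coefXn; case: j j_gt0 => // j _; rewrite mulr0.
have size_p : (size p <= d.+1)%N.
  rewrite p_coef (leq_trans (size_polyD _ _)) // geq_max size_poly1 /= big_nat.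
  apply: (leq_trans (size_sum _ _ _)); apply/bigmax_leqP_seq => j _ /andP[_ jd].
  by rewrite (leq_trans (size_scale_leq _ _)) // size_polyXn.
rewrite tr_re_mxE linearZ /= -/(growth_exponent A p`_1 p`_2).
have [b [s [pE size_s s_le0]]] : exists b s,
    [/\ p = linear_prod (b :: s), ((size s).+1 <= d)%N &
        {in b :: s, forall c, Im c <= 0}].
  have [[|b s] pE [sizeE s_le0]] := linear_factorization _ _ p0 p_stable.
    (* A constant [p] has no factor, so the trivial one with [b = 0] is inserted; [0 < d] leaves
       room for it. *)
    exists 0, [::]; split=> // [|c]; last by rewrite inE => /eqP ->.
    by rewrite pE /linear_prod big_nil big_seq1 scale0r addr0.
  by exists b, s; split=> //; rewrite -ltnS; rewrite sizeE in size_p.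
rewrite pE; apply: le_trans (frobenius_norm_linear_prod_le _ _ _ _ _ s_le0) _.
(* There may be fewer than [d] factors; the power can be raised to [d] since its base is at least
   1. *)
rewrite sqrtrX ?ler0n // ler_wpM2r ?expR_ge0 // ler_weXn2l //.
by rewrite -[leLHS]sqrtr1 ler_wsqrtr // ler1n.
Qed.
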